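(* Let $\mathcal L=\{L_i:i\in I\}$ be a family of pairwise distinct compact convex sets in $\mathbb R^d$ such that $\mathrm{conv}(\mathcal L)$ is compact and $\dim\mathrm{conv}(\mathcal L)>0$, and which are in general position. If $i\in I$ is such that $L_i$ is not contributing to $\mathcal L$, i.e. $\mathrm{conv}\bigl(\bigcup_{j\in I}L_j\bigr)=\mathrm{conv}\bigl(\bigcup_{j\in I\setminus\{i\}}L_j\bigr)$, then $$L_i\subseteq\operatorname{relint}\Bigl(\mathrm{conv}\Bigl(\bigcup_{j\in I\setminus\{i\}}L_j\Bigr)\Bigr)=\operatorname{relint}\Bigl(\mathrm{conv}\Bigl(\bigcup_{j\in I}L_j\Bigr)\Bigr).$$
   Context: For a family $\mathcal L=\{L_i:i\in I\}$ of sets, $\mathrm{conv}(\mathcal L)$ is the convex hull of $\bigcup_{i\in I}L_i$; $\dim$ is the affine dimension and $\operatorname{relint}$ the relative interior. An exposed face of a compact convex set $C$ is a set $C\cap H$ with $H$ a supporting hyperplane of $C$. A family $\mathcal L$ as in the claim (compact convex hull of positive dimension) is said to be in general position if, for each closed convex subset $A$ of each exposed face of $\mathrm{conv}(\mathcal L)$, the family $\mathcal M(\mathcal L,A)=\{L\in\mathcal L:L\cap A\neq\varnothing\}$ is finite and $$\sum_{L\in\mathcal M(\mathcal L,A)}(1+\dim(A\cap L))\le\dim(A)+1.$$ *)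

(* Defs.v *)
From HB Require Import structures.
From mathcomp Require Import all_boot all_order all_algebra.
From mathcomp Require Import all_classical all_reals all_analysis.

Set Implicit Arguments.
Unset Strict Implicit.
Unset Printing Implicit Defensive.

Import Order.TTheory GRing.Theory Num.Theory.
Import numFieldNormedType.Exports.

Local Open Scope classical_set_scope.
Local Open Scope ring_scope.

Section ConvexGeometry.
Context {R : realType} {d : nat}.
Local Notation E := 'rV[R]_d.
Implicit Types (A C F H : set E) (x y u : E) (V : {vspace E}).

Definition convex_hull A : set E := smallest (fun B : set E => convex_set B) A.

Definition affine_set A : Prop :=
  forall x y (t : R), A x -> A y -> A (t *: x + (1 - t) *: y).

Definition affine_hull A : set E := smallest affine_set A.

Definition is_direction A V : Prop :=
  exists x, affine_hull A = [set y | y - x \in V].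

(* The dimension of the affine hull, with dim(set0) = -1.  For a nonempty A,
   [xget] picks the unique V with [is_direction A V]; see [direction_exists]
   and [affine_dimE]. *)
Definition affine_dim A : int :=
  if A == set0 then -1 else (\dim (xget 0%VS [set V | is_direction A V]))%:Z.

Lemma affine_affine_hull A : affine_set (affine_hull A).
Proof.
by move=> x y t hx hy B BA; apply: (BA.1); [exact: hx|exact: hy].
Qed.

Lemma affine_lin A x (t : R) (v w : E) : affine_set A ->
  A x -> A (x + v) -> A (x + w) -> A (x + (t *: v + w)).
Proof.
move=> aA Ax Av Aw.
have scale (s : R) u : A (x + u) -> A (x + s *: u).
  move=> Au; have := aA _ _ s Au Ax; congr A.
  by rewrite scalerDr scalerBl scale1r addrAC addrCA subrr addr0.
have h : 1 - 2^-1 = 2^-1 :> R.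
  by rewrite {1}(splitr 1) mul1r addrK.
have h2 : 2%:R * 2^-1 = 1 :> R by rewrite mulfV// pnatr_eq0.
have := aA _ _ 2^-1 (scale (2%:R * t) _ Av) (scale 2%:R _ Aw).
congr A; rewrite h !scalerDr !scalerA mulrA mulVf ?pnatr_eq0// mul1r.
by rewrite scale1r addrACA -scalerDl -[X in X + X]mul1r -splitr scale1r.
Qed.

Lemma direction_exists A : A !=set0 -> exists V, is_direction A V.
Proof.
move=> [x Ax]; have Hx : affine_hull A x by exact: sub_smallest Ax.
pose inside V := forall v, v \in V -> affine_hull A (x + v).
pose P n := `[< exists2 V : {vspace E}, \dim V = n & inside V >].
have P0 : exists n, P n.
  exists 0%N; apply/asboolP; exists 0%VS; first by rewrite dimv0.
  by move=> v; rewrite memv0 => /eqP ->; rewrite addr0.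
have Pmax n : P n -> (n <= \dim {:E})%N.
  by move=> /asboolP[V <- _]; exact/dimvS/subvf.
case: (ex_maxnP P0 Pmax) => n /asboolP[V Vn VI] nmax.
exists V, x; apply/seteqP; split=> y /=; last by move=> /VI; rewrite addrC subrK.
move=> Hy; have W : inside (V + <[(y - x)%R]>)%VS.
  move=> v /memv_addP[a aV [_ /vlineP[t ->] ->]].
  have Hv : affine_hull A (x + (y - x)) by rewrite addrC subrK.
  have Hw : affine_hull A (x + a) by exact: VI.
  have := affine_lin t (@affine_affine_hull A) Hx Hv Hw.
  by rewrite [_ + a]addrC.
have /eqP WV : V == (V + <[(y - x)%R]>)%VS.
  rewrite eqEdim addvSl /= Vn; apply: nmax.
  by apply/asboolP; exists (V + <[(y - x)%R]>)%VS.
by rewrite WV; apply: (subvP (addvSr _ _)); exact: memv_line.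
Qed.

Lemma affine_dimE A V : is_direction A V -> affine_dim A = (\dim V)%:Z.
Proof.
move=> AV; have [x Ex] := AV; rewrite /affine_dim.
have [A0|_] := eqVneq A set0.
  have : affine_hull A x by rewrite Ex /= subrr mem0v.
  have hull0 : affine_hull (set0 : set E) `<=` set0 by apply: smallest_sub.
  by rewrite A0 => /hull0.
case: xgetP => [_ -> [y Ey]|/(_ V)//].
suff sub (V1 V2 : {vspace E}) (x1 x2 : E) :
    affine_hull A = [set y | y - x1 \in V1] ->
    affine_hull A = [set y | y - x2 \in V2] -> (V1 <= V2)%VS.
  by congr (_%:Z); apply/eqP; rewrite eqn_leq !dimvS//; apply: sub; eassumption.
move=> -> E12; apply/subvP => v vV1.
have : [set y | y - x1 \in V1] x1 by rewrite /= subrr mem0v.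
have : [set y | y - x1 \in V1] (x1 + v) by rewrite /= addrC addrA addNr add0r.
rewrite E12 /= => h1 h2; have := rpredB h1 h2.
by rewrite opprB addrA subrK addrC addrA addNr add0r.
Qed.

Definition relint A : set E :=
  [set x | affine_hull A x /\ \forall y \near within (affine_hull A) (nbhs x), A y].

Definition dotp u x : R := (u *m x^T) 0 0.

(* A hyperplane containing C is excluded: it is not regarded as supporting C,
   so that exposed faces of C are proper subsets of C also when C is not
   full-dimensional. *)
Definition supporting_hyperplane C H : Prop :=
  exists u (c : R),
    [/\ u != 0, H = [set x | dotp u x = c],
        (forall x, C x -> dotp u x <= c),
        C `&` H !=set0 & ~ (C `<=` H)].

Definition exposed_face C F : Prop :=
  exists2 H, supporting_hyperplane C H & F = C `&` H.

Definition conv_family {I : Type} (L : I -> set E) (J : set I) : set E :=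
  convex_hull (\bigcup_(j in J) L j).

Definition meeting {I : Type} (L : I -> set E) A : set (set E) :=
  [set K | range L K /\ K `&` A !=set0].

Definition general_position {I : Type} (L : I -> set E) : Prop :=
  forall F A, exposed_face (conv_family L setT) F ->
    A `<=` F -> closed A -> convex_set A ->
    finite_set (meeting L A) /\
    \sum_(K \in meeting L A) (1 + affine_dim (A `&` K)) <= affine_dim A + 1.

Definition not_contributing {I : Type} (L : I -> set E) (i : I) : Prop :=
  conv_family L setT = conv_family L [set~ i].

End ConvexGeometry.

(* Main.v *)
(* If x in L_i is not in relint C, where C = conv L, some exposed face F of C
   contains x.  An exposed face of a convex hull is the hull of the generating
   points it contains, and L_i is not contributing, so F is the hull of the sets
   F :&: L_j with j <> i, whence dim F + 1 <= sum_{j <> i} (1 + dim (F :&: L_j))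
   over the L_j meeting F.  Since L_i also meets F, this contradicts the general
   position inequality for A = F. *)

Require Import Defs.
From HB Require Import structures.
From mathcomp Require Import all_boot all_order all_algebra.
From mathcomp Require Import all_classical all_reals all_analysis.
From mathcomp Require Import ring lra.

Set Implicit Arguments.
Unset Strict Implicit.
Unset Printing Implicit Defensive.

Import Order.TTheory GRing.Theory Num.Theory.
Import numFieldNormedType.Exports.

Local Open Scope classical_set_scope.
Local Open Scope ring_scope.

Section ConvexGeometry.
Context {R : realType} {d : nat}.
Local Notation E := 'rV[R]_d.
Implicit Types (A C G : set E) (x y z u w : E) (V : {vspace E}).

(** * Convexity and affine flats *)

Lemma convex_setE A : convex_set A <->
  forall x y (t : R), 0 <= t -> t <= 1 -> A x -> A y ->
    A (t *: x + (1 - t) *: y).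
Proof.
split=> [cA x y t t0 t1 Ax Ay|cA x y t].
  by have := cA x y (Itv01 t0 t1); rewrite !inE; apply.
by rewrite !inE => Ax Ay; apply: cA.
Qed.

Lemma convex_hull_convex A : convex_set (convex_hull A).
Proof.
apply/convex_setE => x y t t0 t1 hx hy B BA.
by case: (BA) => /convex_setE cB _; apply: cB => //; [exact: hx|exact: hy].
Qed.

Lemma affine_convex A : affine_set A -> convex_set A.
Proof. by move=> aA; apply/convex_setE => x y t _ _; exact: aA. Qed.

Lemma affine_translate x V : affine_set [set y | y - x \in V].
Proof.
move=> y z t /= yV zV.
suff -> : t *: y + (1 - t) *: z - x = t *: (y - x) + (1 - t) *: (z - x).
  by rewrite rpredD// rpredZ.
rewrite !scalerBr addrACA -opprD -scalerDl.
by rewrite addrCA subrr addr0 scale1r.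
Qed.

(** * Dimension bounds through enclosing flats *)

Lemma affine_dim_le A x V : A !=set0 -> A `<=` [set y | y - x \in V] ->
  affine_dim A <= (\dim V)%:Z.
Proof.
move=> /direction_exists[W dW] AV; rewrite (affine_dimE dW) lez_nat.
have hullV : affine_hull A `<=` [set y | y - x \in V].
  by apply: smallest_sub => //; exact: affine_translate.
have [y hully] := dW; rewrite hully in hullV.
apply/dimvS/subvP => w wW.
have -> : w = (y + w - x) - (y - x).
  by rewrite opprB addrA subrK [y + w]addrC addrK.
apply: rpredB; apply: hullV => /=; last by rewrite subrr mem0v.
by rewrite [y + w]addrC addrK.
Qed.

Lemma affine_dim_flat A : A !=set0 -> exists x V,
  A `<=` [set y | y - x \in V] /\ affine_dim A = (\dim V)%:Z.
Proof.
move=> /direction_exists[V dV]; have [x hullV] := dV.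
exists x, V; split; last exact: affine_dimE.
by rewrite -hullV; exact: sub_gen_smallest.
Qed.

(** Two flats [x + V] and [y + W] lie in the flat through [x] with direction [V + W + <[y - x]>].
    The vector joining the base points costs at most one dimension, which accounts for the [1] in
    each summand. *)
Lemma common_flat (s : seq (set E)) : s != [::] ->
  (forall A, A \in s -> A !=set0) -> exists x V,
  (forall A, A \in s -> A `<=` [set y | y - x \in V]) /\
  (\dim V)%:Z + 1 <= \sum_(A <- s) (1 + affine_dim A).
Proof.
elim: s => // A s IH _ s0.
have [x [V [AV dimA]]] := affine_dim_flat (s0 A (mem_head _ _)).
(* The induction starts from a single set: an empty sum is [0], too small to bound any
   [\dim V + 1]. *)
have [->|sN] := eqVneq s [::].
  exists x, V; split=> [B|]; first by rewrite inE => /eqP ->.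
  by rewrite big_seq1 dimA addrC.
case: IH => // [B Bs|y [W [sW dimW]]]; first by apply: s0; rewrite inE Bs orbT.
exists x, (V + (W + <[y - x]>))%VS; split=> [B|].
  rewrite inE => /orP[/eqP ->|/sW BW] z /=.
    by move=> /AV /=; exact/subvP/addvSl.
  move=> /BW /= zW; apply: (subvP (addvSr _ _)).
  by rewrite -[z](subrK y) -addrA memv_add ?memv_line//.
have dimline : (\dim <[y - x]> <= 1)%N by rewrite dim_vline leq_b1.
have [dimVW _] := dimv_add_leqif V (W + <[y - x]>)%VS.
have [dimWl _] := dimv_add_leqif W <[y - x]>%VS.
have dimU : (\dim (V + (W + <[y - x]>)) <= \dim V + (\dim W + 1))%N.
  exact: leq_trans dimVW (leq_add _ (leq_trans dimWl (leq_add _ dimline))).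
rewrite big_cons dimA -addrA [1 + _]addrC lerD2r.
apply: le_trans (_ : (\dim V)%:Z + ((\dim W)%:Z + 1) <= _);
  last by rewrite lerD2l.
exact: dimU.
Qed.

(** * The dot product, continuity and closedness *)

Lemma dotpDr u x y : dotp u (x + y) = dotp u x + dotp u y.
Proof. by rewrite /dotp linearD mulmxDr mxE. Qed.

Lemma dotpZr u (t : R) x : dotp u (t *: x) = t * dotp u x.
Proof. by rewrite /dotp linearZ -scalemxAr mxE. Qed.

Lemma dotpBr u x y : dotp u (x - y) = dotp u x - dotp u y.
Proof. by rewrite dotpDr -scaleN1r dotpZr mulN1r. Qed.

Lemma dotpE u x : dotp u x = \sum_j u 0 j * x 0 j.
Proof. by rewrite /dotp mxE; apply: eq_bigr => j _; rewrite mxE. Qed.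

Lemma dotpC u x : dotp u x = dotp x u.
Proof. by rewrite !dotpE; apply: eq_bigr => j _; rewrite mulrC. Qed.

Lemma dotp_subZ u w (t : R) : dotp (u - t *: w) (u - t *: w) =
  dotp u u - t * dotp u w - t * (dotp u w - t * dotp w w).
Proof.
rewrite dotpBr dotpZr !(dotpC (u - _)) !dotpBr !dotpZr (dotpC w u); ring.
Qed.

Lemma dotp_ge0 x : 0 <= dotp x x.
Proof. by rewrite dotpE sumr_ge0// => j _; rewrite -expr2 sqr_ge0. Qed.

Lemma dotp_eq0 x : (dotp x x == 0) = (x == 0).
Proof.
apply/eqP/eqP => [|->]; last first.
  by rewrite dotpE big1// => j _; rewrite mxE mul0r.
rewrite dotpE => /psumr_eq0P x0; apply/rowP => j; rewrite mxE.
apply/eqP; rewrite -sqrf_eq0 expr2 x0// => k _.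
by rewrite -expr2 sqr_ge0.
Qed.

Lemma cvg_dotp (T : Type) (F : set_system T) (FF : Filter F) (f g : T -> E)
    u x :
  f @ F --> u -> g @ F --> x -> dotp (f t) (g t) @[t --> F] --> dotp u x.
Proof.
move=> fu gx; rewrite dotpE; under eq_fun do rewrite dotpE.
apply: cvg_big => [|j _]; first exact: add_continuous.
apply: cvgM.
  exact: (cvg_comp f _ fu (@coord_continuous R 1 d 0 j u)).
exact: (cvg_comp g _ gx (@coord_continuous R 1 d 0 j x)).
Qed.

Lemma linear_rV_continuous (f : {linear E -> E}) : continuous f.
Proof.
move=> u.
have fE : f = (fun v => \sum_j v 0 j *: f (delta_mx 0 j)) :> (E -> E).
  apply/funext => v; rewrite {1}(row_sum_delta v) linear_sum.
  by apply: eq_bigr => j _; rewrite linearZ.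
rewrite fE; have FF : Filter (nbhs u) := nbhs_filter u.
apply: cvg_big => [|j _]; first exact: add_continuous.
by apply: cvgZl; exact: (@coord_continuous R 1 d 0 j u).
Qed.

Lemma closed_vspace V : closed [set u | u \in V].
Proof.
have -> : [set u | u \in V] = (fun u => projv V u - u) @^-1` [set 0].
  apply/seteqP; split=> u /=; first by move/projv_id ->; rewrite subrr.
  by move/subr0_eq <-; exact: memv_proj.
apply: preimage_closed => [u _|].
  apply: (cvgB (F := nbhs u)); last exact: cvg_id.
  exact: (@linear_rV_continuous (projv V)).
apply: accessible_closed_set1; apply: hausdorff_accessible.
exact: norm_hausdorff.
Qed.

(** * Nearest points and supporting hyperplanes *)

Lemma nearest_point C y : compact C -> convex_set C -> C !=set0 ->
  exists2 p, C p & forall z, C z -> dotp (y - p) (z - p) <= 0.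
Proof.
move=> cC /convex_setE vC C0.
have [|p /set_mem Cp pmin] :=
  EVT_min_rV (f := fun z => dotp (y - z) (y - z)) C0 cC.
  apply: continuous_subspaceT => z.
  have cB : y - t @[t --> z] --> y - z.
    by apply: (cvgB (F := nbhs z)); [exact: cvg_cst|exact: cvg_id].
  exact: (cvg_dotp (F := nbhs z) _ cB cB).
exists p => // z Cz; rewrite leNgt; apply/negP => a0.
set u := y - p in pmin a0; set w := z - p in a0.
(* If a > 0, then p + t w with t = a / (a + b) is closer to y than p. *)
set a := dotp u w in a0; set b := dotp w w.
have b0 : 0 <= b := dotp_ge0 w.
have ab0 : 0 < a + b by lra.
pose t := a / (a + b).
have t0 : 0 < t by rewrite divr_gt0.
have t1 : t <= 1 by rewrite ler_pdivrMr// mul1r lerDl.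
have tab : t * (a + b) = a by rewrite mulfVK// gt_eqF.
have := pmin _ (mem_set (vC z p t (ltW t0) t1 Cz Cp)).
have -> : t *: z + (1 - t) *: p = p + t *: w.
  by rewrite /w scalerBl scale1r scalerBr addrCA.
(* Since [t * b = a - t * a], passing from [p] to [p + t *: w] lowers the squared distance to [y] by
   [t * (a + t * a) > 0], against the minimality of [p]. *)
rewrite opprD addrA -/u dotp_subZ -/a -/b.
have ta0 : 0 < t * a by rewrite mulr_gt0.
have tb : t * b = a - t * a by lra.
rewrite tb => h.
have : 0 < t * (a + t * a) by rewrite mulr_gt0// addr_gt0.
nra.
Qed.

Lemma affine_hull_level u (c : R) A : A `<=` [set x | dotp u x = c] ->
  affine_hull A `<=` [set x | dotp u x = c].
Proof.
move=> Ac; apply: smallest_sub => // x y t /= ux uy.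
by rewrite dotpDr !dotpZr ux uy -mulrDl addrC subrK mul1r.
Qed.

(* By compactness of the unit sphere S of the direction space V: if every u in S
   has dotp u (z - x) > 0 for some z in C, then the same holds with x replaced by
   any y near x; such a y in the affine hull must lie in C, since otherwise the
   normalization of y - p, with p the point of C nearest to y, contradicts it. *)
Lemma supporting_hyperplane_exists C x : compact C -> convex_set C ->
  C x -> ~ relint C x -> exists2 H, supporting_hyperplane C H & H x.
Proof.
move=> cC vC Cx xNri; apply: contrapT => noH.
have hullCx : affine_hull C x by exact: sub_gen_smallest.
have [V [x0 hullV]] := direction_exists (ex_intro _ _ Cx).
have hullB y : affine_hull C y -> forall p, affine_hull C p -> y - p \in V.
  rewrite hullV => /= yV p pV.
  have -> : y - p = (y - x0) - (p - x0) by rewrite opprB addrA subrK.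
  exact: rpredB.
(* The norm here is the maximum norm of row vectors, not the one induced by [dotp]; what matters is
   that [S] is compact, avoids [0] and meets every ray of [V]. *)
pose S := [set u | u \in V] `&` [set u | `|u| = 1].
have cS : compact S.
  apply: bounded_closed_compact.
    by exists 1; split=> // M M1 u [_ /= ->]; exact: ltW.
  apply: closedI; first exact: closed_vspace.
  apply: (@preimage_closed _ _ (fun u : E => `|u|) [set 1]);
    last exact: closed_eq.
  by move=> u _; exact: norm_continuous.
(* Otherwise the level set of [u] through [x] supports [C]. It cannot contain [C]: as [u] lies in
   [V], the affine hull contains [x + u], and [dotp u u] would vanish. *)
have Sx u : S u -> exists2 z, C z & 0 < dotp u (z - x).
  move=> [/= uV u1]; apply: contrapT => nz; apply: noH.
  have uN0 : u != 0 by rewrite -normr_eq0 u1 oner_neq0.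
  exists [set y | dotp u y = dotp u x] => //; exists u, (dotp u x).
  split=> // [z Cz||CH].
  - rewrite leNgt; apply/negP => zx; apply: nz.
    by exists z; rewrite // dotpBr subr_gt0.
  - by exists x.
  have : affine_hull C (x + u).
    by move: hullCx; rewrite hullV /= => xV; rewrite addrAC rpredD.
  move/(affine_hull_level CH) => /= /eqP.
  by rewrite dotpDr -subr_eq0 addrAC subrr add0r dotp_eq0 (negbTE uN0).
apply: xNri; split=> //.
have : \forall y \near x, S `<=` [set u | exists2 z, C z & 0 < dotp u (z - y)].
  have nS : near_covering S by exact/compact_near_coveringP.
  have := nS E (nbhs x) (fun y u => exists2 z, C z & 0 < dotp u (z - y)) _.
  apply=> u Su.
  have [z Cz uz] := Sx _ Su.
  have lim : dotp q.1 (z - q.2) @[q --> (nbhs u, nbhs x)] --> dotp u (z - x).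
    apply: cvg_dotp; first exact: cvg_fst.
    by apply: cvgB; [exact: cvg_cst|exact: cvg_snd].
  by near=> q; exists z => //; near: q; exact: cvgr_gt lim _ uz.
apply: filterS => y Sy hully; apply: contrapT => Cy.
have [p Cp pmin] := nearest_point y cC vC (ex_intro _ _ Cx).
have yp : y - p != 0 by apply: contra_notN Cy => /eqP/subr0_eq ->.
have [|z Cz] := Sy (`|y - p|^-1 *: (y - p)).
  split=> /=; last by rewrite normrZ normfV normr_id mulVf// normr_eq0.
  by rewrite rpredZ// hullB//; exact: sub_gen_smallest.
rewrite dotpC dotpZr pmulr_rgt0 ?invr_gt0 ?normr_gt0// dotpC ltNge.
move=> /negP; apply.
have -> : z - y = (z - p) - (y - p) by rewrite opprB addrA subrK.
by rewrite dotpBr subr_le0 (le_trans (pmin _ Cz))// dotp_ge0.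
Unshelve. all: by end_near. Qed.

(** * Faces cut out by a hyperplane *)

Lemma convex_hull_face G u (c : R) : (forall x, G x -> dotp u x <= c) ->
  convex_hull G `&` [set x | dotp u x = c] `<=`
  convex_hull (G `&` [set x | dotp u x = c]).
Proof.
move=> Gc x [Gx /= ux].
(* [B] contains [G] and is convex, so it contains the whole hull. *)
pose B := [set y | dotp u y <= c /\
  (dotp u y = c -> convex_hull (G `&` [set x | dotp u x = c]) y)].
suff : convex_hull G `<=` B by move=> /(_ _ Gx)[_]; exact.
apply: smallest_sub => [|y Gy]; last first.
  by split=> [|uy]; [exact: Gc|exact: sub_gen_smallest].
apply/convex_setE => y z t t0 t1 [yc yB] [zc zB].
split=> /=; rewrite dotpDr !dotpZr; first nra.
(* For [0 < t < 1], a combination at level [c] of points at level at most [c] forces both to level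
   [c]. At [t = 0] or [t = 1] only one point is forced, and it is the combination itself. *)
have [->|tN0] := eqVneq t 0.
  by rewrite !mul0r subr0 mul1r !scale0r scale1r !add0r.
have [->|tN1] := eqVneq t 1.
  by rewrite subrr !mul0r mul1r !scale0r scale1r !addr0.
have tgt0 : 0 < t by rewrite lt_def tN0.
have tlt1 : t < 1 by rewrite lt_neqAle tN1.
move=> uc; have /convex_setE := @convex_hull_convex
  (G `&` [set x | dotp u x = c]).
by apply=> //; [apply: yB|apply: zB]; nra.
Qed.

Lemma closed_hyperplane u (c : R) : closed [set x | dotp u x = c].
Proof.
apply: (@preimage_closed _ _ (dotp u) [set c]); last exact: closed_eq.
move=> x _.
by apply: (cvg_dotp (F := nbhs x)); [exact: cvg_cst|exact: cvg_id].
Qed.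

End ConvexGeometry.

Theorem lemma2p4 (R : realType) (d : nat) (I : Type) (L : I -> set 'rV[R]_d)
  (L_distinct : injective L)
  (L_compact : forall i, compact (L i))
  (L_convex : forall i, convex_set (L i))
  (conv_compact : compact (conv_family L setT))
  (conv_dim : 0 < affine_dim (conv_family L setT))
  (L_gp : general_position L)
  (i : I) (Li_nc : not_contributing L i) :
  L i `<=` relint (conv_family L [set~ i]) /\
  relint (conv_family L [set~ i]) = relint (conv_family L setT).
Proof.
move: Li_nc; rewrite /not_contributing => Ceq; rewrite -Ceq; split=> // x Lx.
apply: contrapT => xNri.
set C := conv_family L setT in Ceq conv_compact xNri *.
have CL j : L j `<=` C by move=> y Ly; apply: sub_gen_smallest; exists j.
have vC : convex_set C by exact: convex_hull_convex.
have [H sH Hx] :=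
  supporting_hyperplane_exists conv_compact vC (CL i _ Lx) xNri.
have [u [c [_ HE Cc _ _]]] := sH.
pose F := C `&` H.
have Fx : F x by split=> //; exact: CL Lx.
have vH : convex_set H.
  rewrite HE; apply: affine_convex => y z t /= uy uz.
  by rewrite dotpDr !dotpZr uy uz -mulrDl addrC subrK mul1r.
have vF : convex_set F.
  move: vC vH => /convex_setE vC /convex_setE vH.
  apply/convex_setE => y z t t0 t1 [Cy Hy] [Cz Hz].
  by split; [exact: vC|exact: vH].
have clF : closed F.
  apply: closedI; last by rewrite HE; exact: closed_hyperplane.
  exact: compact_closed (@norm_hausdorff _ _) conv_compact.
have [Mfin] :=
  L_gp F F (ex_intro2 _ _ H sH erefl) (@subset_refl _ F) clF vF.
pose M := finmap.enum_fset (fset_set (meeting L F)).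
have inM K : (K \in M) = (K \in meeting L F) by exact: in_fset_set.
have LiM : L i \in M by rewrite inM inE; split; [exists i|exists x].
rewrite fsbig_finite//= -/M (bigD1_seq (L i))//= => [dimS|];
  last exact: finmap.fset_uniq.
(* [meeting] collects sets, not indices, so dropping the index [i] becomes dropping the set [L i].
   Injectivity of [L] keeps every other [L j] in the list. *)
pose s := [seq F `&` K | K <- M & K != L i].
have FL : F `<=` convex_hull (\bigcup_(j in [set~ i]) (L j) `&` H).
  rewrite /F Ceq HE; apply: convex_hull_face => y [j _ Ly].
  exact: Cc (CL j _ Ly).
have Ls j : j <> i -> L j `&` H !=set0 -> F `&` L j \in s.
  move=> ji [y [Ly Hy]]; apply/mapP; exists (L j) => //.
  rewrite mem_filter; apply/andP; split; first by apply/eqP=> /L_distinct.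
  rewrite inM; apply/mem_set.
  by split; [exists j|exists y; split=> //; split=> //; exact: CL Ly].
(* If no [L j] with [j <> i] met [H], then [F], which contains [x], would lie in the hull of the
   empty set. *)
have sN : s != [::].
  apply/eqP => s0; have /FL : F x by [].
  suff -> : \bigcup_(j in [set~ i]) L j `&` H = set0.
    by apply: (smallest_sub (X := set0)) => //; apply/convex_setE.
  apply/seteqP; split=> // y [[j /= ji Ly] Hy].
  by have := Ls j ji (ex_intro _ y (conj Ly Hy)); rewrite s0.
have [|a [W [sW dimW]]] := common_flat sN.
  move=> A /mapP[K]; rewrite mem_filter inM => /andP[_ /set_mem[_ KF]] ->.
  by rewrite setIC.
have dimF : affine_dim F <= (\dim W)%:Z.
  apply: affine_dim_le (ex_intro _ x Fx) (subset_trans FL _).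
  apply: smallest_sub; first exact/affine_convex/affine_translate.
  move=> y [[j /= ji Ly] Hy]; apply: (sW _ (Ls j ji _)); first by exists y.
  by split=> //; split=> //; exact: CL Ly.
(* The point [x] rules out the value [-1] of the empty set, so the summand of [L i] is at least
   [1]. *)
have dimLi : 0 <= affine_dim (F `&` L i).
  by have [|b [V [_ ->]]] := @affine_dim_flat _ _ (F `&` L i); first exists x.
rewrite big_map big_filter in dimW.
(* With [S'] the sum over the sets other than [L i], the chain reads [1 + affine_dim (F :&: L i) +
   S' <= affine_dim F + 1 <= \dim W + 1 <= S'], which is absurd. *)
have := le_trans dimS (le_trans (lerD dimF (lexx 1)) dimW).
by rewrite gerDr leNgt ltr_pwDl.
Qed.
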